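(* Consider the shipping game described in the context. Fix a player $h\in H$ and fix a choice of strategies (partitions $P^i$ of $K^i$) by all players $i\in H\setminus\{h\}$. For a partition $P$ of $K^h$ let $\pi(P)$ denote the expected payoff to $h$ if he chooses the partition $P$. If $P,Q$ are partitions of $K^h$ and $P$ is coarser than $Q$, then $\pi(P)\ge\pi(Q)$. In particular, for every player $h$ the coarse partition (the partition of $K^h$ into a single part) is a dominant strategy.
   Context: The shipping game: $K$ is a finite set of commodities and $H$ a finite set of players (suppliers). Each $h\in H$ has a subset $K^h\subseteq K$ (not necessarily disjoint for different $h$) and a probability $p_h\in[0,1]$. A strategy of player $h$ is a partition $P^h$ of $K^h$ into disjoint parts $K^h=K^h_1\sqcup\cdots\sqcup K^h_l$, called shipments. Given a strategy tuple $(P^h)_{h\in H}$, each shipment of each player $h$ arrives with probability $p_h$, all arrivals (across players and across shipments of the same player) being independent; when a shipment arrives, all the commodities in it arrive from $h$, and when it does not, none of them do. For $k\in K$, $S_k\subseteq H$ is the (random) set of players $h$ with $k\in K^h$ whose shipment containing $k$ arrives. The payoff to player $h$ is $F^h(\mathbf{S})=\prod_{k\in K}F^h_k(S_k)$, where $\mathbf{S}=(S_k)_{k\in K}$ and each $F^h_k$ is a given non-negative real-valued function on subsets of $H$ that is increasing: $F^h_k(S)\ge F^h_k(S')$ whenever $S\supseteq S'$ (the functions may depend on $h$). The expected payoff is the expectation of $F^h(\mathbf{S})$. A partition $P$ is coarser than $Q$ if each part of $P$ is a union of parts of $Q$. A strategy of $h$ is dominant if, for every choice of strategies by the other players, it maximizes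 the expected payoff to $h$ over all strategies of $h$. *)

(* Defs.v *)
From mathcomp Require Import all_boot all_order all_algebra.

Set Implicit Arguments.
Unset Strict Implicit.
Unset Printing Implicit Defensive.

Import Order.TTheory GRing.Theory Num.Theory.
Local Open Scope ring_scope.

Record shipping_game (R : realFieldType) (K H : finType) := ShippingGame {
  supply : H -> {set K};
  arrival : H -> R;
  factor : H -> K -> {set H} -> R;
  arrival_itv : forall h, 0 <= arrival h <= 1;
  factor_ge0 : forall h k S, 0 <= factor h k S;
  factor_incr : forall h k (S S' : {set H}),
    S' \subset S -> factor h k S' <= factor h k S
}.

Section ShippingGame.
Variables (R : realFieldType) (K H : finType) (g : shipping_game R K H).

Definition strategy (h : H) (P : {set {set K}}) : bool :=
  partition P (supply g h).

Definition coarser (P Q : {set {set K}}) : Prop :=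
  forall B, B \in P -> exists2 Q' : {set {set K}}, Q' \subset Q & B = cover Q'.

(* Parts of a [partition] are nonempty, so the coarse partition of the empty
   set is the empty family. *)
Definition coarse_partition (D : {set K}) : {set {set K}} := [set D] :\ set0.

(* An outcome [w] records, for each player [i], the set [w i] of those shipments
   of [i] that arrive; the possible outcomes are those with [w i \subset s i]. *)
Definition outcome : Type := {ffun H -> {set {set K}}}.

Definition outcome_of (s : H -> {set {set K}}) (w : outcome) : bool :=
  [forall i, w i \subset s i].

(* The product of the Bernoulli laws of all the shipments. *)
Definition outcome_prob (s : H -> {set {set K}}) (w : outcome) : R :=
  \prod_(i : H) \prod_(B in s i)
    (if B \in w i then arrival g i else 1 - arrival g i).

Definition suppliers (s : H -> {set {set K}}) (w : outcome) (k : K) : {set H} :=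
  [set i | (k \in supply g i) && (pblock (s i) k \in w i)].

Definition payoff (h : H) (S : K -> {set H}) : R :=
  \prod_(k : K) factor g h k (S k).

Definition expected_payoff (h : H) (s : H -> {set {set K}}) : R :=
  \sum_(w : outcome | outcome_of s w)
    outcome_prob s w * payoff h (suppliers s w).

(* The strategies of the players other than [h] are given by a family [s] on all
   of [H], whose value at [h] is never used. *)
Definition others_strategies (h : H) (s : H -> {set {set K}}) : Prop :=
  forall i, i != h -> strategy i (s i).

Definition payoff_against (h : H) (s : H -> {set {set K}}) (P : {set {set K}})
    : R :=
  expected_payoff h (fun i => if i == h then P else s i).

Definition dominant (h : H) (P : {set {set K}}) : Prop :=
  strategy h P /\
  forall s, others_strategies h s ->
    forall Q, strategy h Q -> payoff_against h s Q <= payoff_against h s P.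

End ShippingGame.

(* Main.v *)
Require Import Defs.
From mathcomp Require Import all_boot all_order all_algebra.
From mathcomp Require Import ring.

Set Implicit Arguments.
Unset Strict Implicit.
Unset Printing Implicit Defensive.

Import Order.TTheory GRing.Theory Num.Theory.
Local Open Scope ring_scope.

(** Condition on which shipments of the other players arrive. Then the payoff to
    [h] is a nonnegative constant times the product over [k] in [K^h] of [u k]
    or [l k], where [u k >= l k >= 0], according to whether [k] arrives from [h].
    With the partition [P] its conditional expectation is that constant times
    the product over [B] in [P] of
    [mixture B = p * \prod_(k in B) u k + (1 - p) * \prod_(k in B) l k]. By
    Chebyshev's inequality for two monotone functions of one Bernoulli variable,
    [mixture] is supermultiplicative on disjoint sets, so merging shipments can
    only increase the product. *)

(** Extend the factors outside [A] by [0 + 1] and distribute over all subsets of [I]: any [J] not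
    inside [A] picks up a factor [0]. This will turn a sum over the arriving shipments of [h] into a
    product over shipments. *)
Lemma prodrD_subset (R : comNzRingType) (I : finType) (A : {set I})
    (F G : I -> R) :
  \prod_(i in A) (F i + G i) =
  \sum_(J : {set I} | J \subset A)
     \prod_(i in A) (if i \in J then F i else G i).
Proof.
rewrite big_mkcond /=.
transitivity (\prod_i ((if i \in A then F i else 0)
                       + (if i \in A then G i else 1))).
  by apply: eq_bigr => i _; case: ifP => _ //; rewrite add0r.
rewrite bigA_distr (bigID (fun J : {set I} => J \subset A)) /=.
rewrite [X in _ + X]big1 ?addr0 => [|J /subsetPn[i iJ iA]].
  apply: eq_bigr => J sJA; rewrite [RHS]big_mkcond; apply: eq_bigr => i _.
  by case: ifP => iJ; case: ifP => // iA; rewrite (subsetP sJA) in iA.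
by rewrite (bigD1 i) //= iJ (negPf iA) mul0r.
Qed.

Section Mixture.
Variables (R : realFieldType) (K : finType) (p : R) (u l : K -> R).
Hypothesis p_itv : 0 <= p <= 1.
Hypothesis l_ge0 : forall k, 0 <= l k.
Hypothesis le_lu : forall k, l k <= u k.

Definition mixture (B : {set K}) : R :=
  p * (\prod_(k in B) u k) + (1 - p) * (\prod_(k in B) l k).

Lemma mixture_ge0 (B : {set K}) : 0 <= mixture B.
Proof.
have /andP[p0 p1] := p_itv.
rewrite addr_ge0 ?mulr_ge0 ?subr_ge0 ?prodr_ge0 // => k _.
exact: le_trans (l_ge0 k) (le_lu k).
Qed.

Lemma mixture_setU (B C : {set K}) :
  [disjoint B & C] -> mixture B * mixture C <= mixture (B :|: C).
Proof.
move=> dBC; have prodU f : \prod_(k in B :|: C) f k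
    = (\prod_(k in B) f k) * (\prod_(k in C) f k) :> R.
  by rewrite -(bigU _ _ _ dBC); apply: eq_bigl => k; rewrite !inE.
rewrite /mixture !prodU -subr_ge0.
set b := \prod_(k in B) u k; set c := \prod_(k in C) u k.
set b' := \prod_(k in B) l k; set c' := \prod_(k in C) l k.
(* The difference is the covariance of two functions of one Bernoulli variable, with values [b],
   [b'] and [c], [c']. *)
have -> : p * (b * c) + (1 - p) * (b' * c')
          - (p * b + (1 - p) * b') * (p * c + (1 - p) * c')
        = p * (1 - p) * ((b - b') * (c - c')) by ring.
have /andP[p0 p1] := p_itv.
by rewrite !mulr_ge0 ?subr_ge0 //; apply: ler_prod => k _; rewrite l_ge0 le_lu.
Qed.

Lemma mixture_cover (P : {set {set K}}) :
  trivIset P -> \prod_(B in P) mixture B <= mixture (cover P).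
Proof.
have [n] := ubnP #|P|; elim: n P => // n IHn P; rewrite ltnS => leP tP.
have [->|[B BP]] := set_0Vmem P.
  by rewrite /cover /mixture !big_set0 !mulr1 addrC subrK.
have sP : P :\ B \subset P by apply: subD1set.
rewrite (big_setD1 B BP) /= /cover (big_setD1 B BP) /=.
apply: le_trans (mixture_setU _).
  rewrite ler_wpM2l ?mixture_ge0 // IHn ?(trivIsetS sP) //.
  by rewrite (cardsD1 B) BP in leP.
apply/bigcup_disjointP => C; rewrite !inE => /andP[CB CP].
by rewrite disjoint_sym; move/trivIsetP: tP; apply.
Qed.

(** Group the blocks of [Q] by the block of [P] that contains them and apply [mixture_cover] to each
    group. *)
Lemma mixture_coarser (D : {set K}) (P Q : {set {set K}}) :
  partition P D -> partition Q D -> coarser P Q ->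
  \prod_(B in Q) mixture B <= \prod_(B in P) mixture B.
Proof.
case/and3P=> /eqP covP tP _ /and3P[/eqP covQ tQ Q0] cPQ.
(* The default [set0] is never reached for [C] in [Q]: a point [k] of [C] lies in some [B] of [P],
   and the block of [Q] around [k] inside [B] must be [C]. *)
pose block (C : {set K}) := odflt set0 [pick B in P | C \subset B].
have blockP C : C \in Q -> block C \in P /\ C \subset block C.
  move=> CQ; rewrite /block; case: pickP => [B /andP[] //|noB].
  have C0 : C != set0 by apply: contraNneq Q0 => <-.
  have /set0Pn[k kC] := C0.
  have : k \in cover P by rewrite covP -covQ; apply/bigcupP; exists C.
  case/bigcupP=> B BP kB; have [Q' sQ' defB] := cPQ B BP.
  move: (kB); rewrite defB => /bigcupP[C' C'Q' kC'].
  have defC : C' = C.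
    by rewrite -(def_pblock tQ CQ kC) (def_pblock tQ (subsetP sQ' _ C'Q') kC').
  move: (noB B); rewrite /= BP /= => /negbT/negP[].
  by rewrite -defC defB; apply: bigcup_sup.
rewrite (partition_big block (mem P)) /= => [|C /blockP[] //].
apply: ler_prod => B BP.
rewrite prodr_ge0 => [|C _]; last exact: mixture_ge0.
have [Q' sQ' defB] := cPQ B BP.
rewrite -big_set /=; set Q_B := [set C in _ | _].
have sQB : Q_B \subset Q by apply/subsetP=> C; rewrite inE => /andP[].
apply: le_trans (mixture_cover (trivIsetS sQB tQ)) _.
(* [B] is a union of blocks [C] of [Q]; each such [C] is nonempty and lies in both [B] and
   [block C], so these coincide by disjointness in [P]. *)
suff -> : cover Q_B = B by [].
apply/eqP; rewrite eqEsubset; apply/andP; split.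
  apply/bigcupsP=> C; rewrite inE => /andP[/blockP[_ sC] /eqP defC].
  by rewrite defC in sC.
rewrite {1}defB; apply/bigcupsP=> C CQ'; apply: bigcup_sup.
have CQ := subsetP sQ' _ CQ'; rewrite inE CQ /=; have [bP sCb] := blockP C CQ.
have /set0Pn[k kC] : C != set0 by apply: contraNneq Q0 => <-.
have kB : k \in B by rewrite defB; apply/bigcupP; exists C.
by rewrite -(def_pblock tP bP (subsetP sCb k kC)) (def_pblock tP BP kB).
Qed.

End Mixture.

Section Conditioning.
Variables (R : realFieldType) (K H : finType) (g : shipping_game R K H).
Variables (h : H) (s : H -> {set {set K}}).

(** At [P := set0] player [h] ships nothing, so [play set0] describes the other players alone. *)
Definition play (P : {set {set K}}) (i : H) : {set {set K}} :=
  if i == h then P else s i.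

Definition with_arrivals (v : outcome K H) (A : {set {set K}}) : outcome K H :=
  [ffun i => if i == h then A else v i].

Lemma outcome_sum_split (P : {set {set K}}) (F : outcome K H -> R) :
  \sum_(w | outcome_of (play P) w) F w =
  \sum_(v | outcome_of (play set0) v)
    \sum_(A : {set {set K}} | A \subset P) F (with_arrivals v A).
Proof.
rewrite pair_big_dep /=.
(* The inverse map erases the entry of [w] at [h], as [outcome_of (play set0)] demands, and records
   it separately. *)
rewrite (reindex_onto (fun vA => with_arrivals vA.1 vA.2)
                      (fun w => (with_arrivals w set0, w h))) /=; last first.
  by move=> w _; apply/ffunP=> i; rewrite !ffunE; case: eqP => // ->.
apply: eq_bigl => -[v A] /=; rewrite ffunE eqxx.
apply/andP/andP => [[/forallP okw /eqP[defv]]|[/forallP okv sAP]].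
  split; last by have := okw h; rewrite /play ffunE eqxx.
  apply/forallP=> i; rewrite -defv; have := okw i; rewrite /play !ffunE.
  by case: eqP => // _; rewrite sub0set.
split.
  by apply/forallP=> i; have := okv i; rewrite /play ffunE; case: eqP.
rewrite xpair_eqE eqxx andbT; apply/eqP/ffunP=> i; rewrite !ffunE.
have := okv i; rewrite /play; case: eqP => // _.
by rewrite subset0 => /eqP->.
Qed.

Lemma outcome_prob_split (P A : {set {set K}}) (v : outcome K H) :
  outcome_prob g (play P) (with_arrivals v A) =
  outcome_prob g (play set0) v *
    \prod_(B in P) (if B \in A then arrival g h else 1 - arrival g h).
Proof.
rewrite /outcome_prob (bigD1 h) //= [in RHS](bigD1 h) //= {1 3}/play eqxx.
rewrite big_set0 mul1r mulrC; congr (_ * _); last first.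
  by apply: eq_bigr => B _; rewrite ffunE eqxx.
apply: eq_bigr => i /negPf ih.
by rewrite /play ih; apply: eq_bigr => B _; rewrite ffunE ih.
Qed.

Lemma suppliers_split (P A : {set {set K}}) (v : outcome K H) (k : K) :
  outcome_of (play set0) v ->
  suppliers g (play P) (with_arrivals v A) k =
  if (k \in supply g h) && (pblock P k \in A)
  then h |: suppliers g (play set0) v k else suppliers g (play set0) v k.
Proof.
move=> /forallP okv; have /eqP vh : v h == set0.
  by have := okv h; rewrite /play eqxx subset0.
apply/setP=> i; rewrite (fun_if (fun S : {set H} => i \in S)) !inE ffunE /play.
by case: eqP => [->|_] /=; rewrite ?vh ?inE ?andbF /=; case: ifP.
Qed.

Definition factor_with (v : outcome K H) (k : K) : R :=
  factor g h k (h |: suppliers g (play set0) v k).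

Definition factor_without (v : outcome K H) (k : K) : R :=
  factor g h k (suppliers g (play set0) v k).

(** Commodities outside [supply g h] do not depend on [A]; the others are grouped by shipment, since
    all of a shipment shares one fate. *)
Lemma payoff_split (P A : {set {set K}}) (v : outcome K H) :
  outcome_of (play set0) v -> strategy g h P ->
  payoff g h (suppliers g (play P) (with_arrivals v A)) =
  (\prod_(k | k \notin supply g h) factor_without v k) *
    \prod_(B in P) (if B \in A then \prod_(k in B) factor_with v k
                    else \prod_(k in B) factor_without v k).
Proof.
move=> okv partP; have /and3P[_ tP _] := partP.
rewrite /payoff (bigID (mem (supply g h))) /= mulrC; congr (_ * _).
  by apply: eq_bigr => k /negPf kh; rewrite suppliers_split // kh.
rewrite (set_partition_big _ partP) /=; apply: eq_bigr => B BP.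
have arrB k : k \in B ->
    factor g h k (suppliers g (play P) (with_arrivals v A) k) =
    if B \in A then factor_with v k else factor_without v k.
  move=> kB; rewrite suppliers_split // (def_pblock tP BP kB).
  rewrite -(cover_partition partP) (_ : k \in cover P) /=.
    by case: ifP.
  by apply/bigcupP; exists B.
by case: ifP arrB => BA arrB; apply: eq_bigr.
Qed.

Lemma payoff_againstE (P : {set {set K}}) :
  strategy g h P ->
  payoff_against g h s P =
  \sum_(v | outcome_of (play set0) v)
    outcome_prob g (play set0) v *
    (\prod_(k | k \notin supply g h) factor_without v k) *
    \prod_(B in P)
      mixture (arrival g h) (factor_with v) (factor_without v) B.
Proof.
move=> partP; rewrite /payoff_against /expected_payoff -/(play P).
rewrite outcome_sum_split; apply: eq_bigr => v okv.
(* Expanding the product of the two-term sums [mixture] gives one term for each set [A] of arriving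
   shipments of [h]. *)
rewrite prodrD_subset mulr_sumr; apply: eq_bigr => A _.
rewrite outcome_prob_split payoff_split // mulrACA -big_split /=.
by congr (_ * _); apply: eq_bigr => B _; case: ifP.
Qed.

Lemma outcome_prob_ge0 (t : H -> {set {set K}}) (w : outcome K H) :
  0 <= outcome_prob g t w.
Proof.
apply: prodr_ge0 => i _; apply: prodr_ge0 => B _.
by have /andP[p0 p1] := arrival_itv g i; case: ifP; rewrite ?subr_ge0.
Qed.

Lemma payoff_against_coarser (P Q : {set {set K}}) :
  strategy g h P -> strategy g h Q -> coarser P Q ->
  payoff_against g h s Q <= payoff_against g h s P.
Proof.
move=> partP partQ cPQ; rewrite !payoff_againstE //.
apply: ler_sum => v _; apply: ler_wpM2l.
  rewrite mulr_ge0 ?outcome_prob_ge0 ?prodr_ge0 // => k _.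
  exact: factor_ge0.
apply: mixture_coarser partP partQ cPQ.
- exact: arrival_itv.
- by move=> k; apply: factor_ge0.
- by move=> k; apply: factor_incr; apply: subsetUr.
Qed.

End Conditioning.

Lemma coarse_partitionP (K : finType) (D : {set K}) :
  partition (coarse_partition D) D.
Proof.
rewrite /coarse_partition; have [->|D0] := eqVneq D set0.
  by rewrite setDv partition_set0.
rewrite (_ : _ :\ _ = [set D]).
  by rewrite /partition cover1 eqxx trivIset1 in_set1 eq_sym D0.
by apply/setP=> B; rewrite !inE; case: eqP => [->|]; case: eqP => // E;
  rewrite ?E ?eqxx in D0 *.
Qed.

(** The only possible block is [D], the union of all of [Q]. *)
Lemma coarse_partition_coarser (K : finType) (D : {set K}) (Q : {set {set K}}) :
  partition Q D -> coarser (coarse_partition D) Q.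
Proof.
move=> partQ B; rewrite !inE => /andP[_ /eqP->].
by exists Q => //; rewrite (cover_partition partQ).
Qed.

Theorem proposition9 (R : realFieldType) (K H : finType)
    (g : shipping_game R K H) :
  (forall (h : H) (s : H -> {set {set K}}),
     others_strategies g h s ->
     forall P Q : {set {set K}},
       strategy g h P -> strategy g h Q -> coarser P Q ->
       payoff_against g h s P >= payoff_against g h s Q)
  /\ (forall h : H, dominant g h (coarse_partition (supply g h))).
Proof.
split=> [h s _ P Q|h]; first exact: payoff_against_coarser.
split=> [|s _ Q partQ]; first exact: coarse_partitionP.
apply: payoff_against_coarser => //; first exact: coarse_partitionP.
exact: coarse_partition_coarser partQ.
Qed.
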